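(* In general, neither the atomic part nor the absolutely continuous part of a Wasserstein barycenter on a metric graph is unique. That is: (1) there exist a metric graph $(G,d)$ and $\mathbb{P}\in\mathcal{W}_2(\mathcal{W}_2(G))$ such that $\mathbb{P}$ has two barycenters whose atomic parts are different; (2) there exist a metric graph $(G,d)$ and $\mathbb{P}\in\mathcal{W}_2(\mathcal{W}_2(G))$ such that $\mathbb{P}$ has two barycenters whose absolutely continuous parts (with respect to the one-dimensional Hausdorff measure $\mathcal{H}$ of $(G,d)$) are different.
   Context: Metric graph. Let $(V,\mathcal{E})$ be a graph: $V$ is an at most countable set of vertices and $\mathcal{E}\subset\{\{x,y\}: x,y\in V, x\ne y\}$ is the set of edges (no loops, no multiple edges). It is assumed connected, with every vertex of finite degree at least $1$. A length function is a map $l:\mathcal{E}\to[0,\infty)$ with $\inf_{e\in\mathcal{E}} l(e)>0$. Each edge $e$, given an orientation $(e_0,e_1)$ of its endpoints, is identified with $[0,l(e)]$, with $e_0$ identified with $0$ and $e_1$ with $l(e)$. The metric graph $G$ is the quotient of the disjoint union of the segments $[0,l(e)]$ (one for each edge), where points representing the same vertex are identified. The distance $d(x,y)$ is the infimum of the lengths of paths in $G$ from $x$ to $y$, a path being a finite concatenation of segments of edges and its length the sum of the lengths of these segments. $\mathcal{H}$ is the one-dimensional Hausdorff measure of $(G,d)$; it gives no mass to $V$ and coincides with the Lebesgue measure on each edge. Wasserstein space. For a metric space $(X,d)$, $\mathcal{W}_2(X)$ is the set of Borel probability measures with finite second order moment, with the quadratic Wasserstein distance $d_W(\mu,\nu)=\left(\min_{\pi}\int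 d^2(x,y)\,d\pi(x,y)\right)^{1/2}$, the minimum being over couplings $\pi$ of $\mu,\nu$. $\mathcal{W}_2(\mathcal{W}_2(X))$ is the same construction applied to $(\mathcal{W}_2(X),d_W)$. A barycenter of $\mathbb{P}\in\mathcal{W}_2(\mathcal{W}_2(X))$ is a minimizer over $\mathcal{W}_2(X)$ of $\mu\mapsto\int d_W(\mu,\nu)^2\,d\mathbb{P}(\nu)$. *)

(* Defs.v *)
From HB Require Import structures.
From mathcomp Require Import all_boot all_order all_algebra generic_quotient.
From mathcomp Require Import all_classical all_reals all_analysis.
From mathcomp Require Import measurable_realfun.

Set Implicit Arguments.
Unset Strict Implicit.
Unset Printing Implicit Defensive.

Import Order.TTheory GRing.Theory Num.Theory.

Local Open Scope classical_set_scope.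
Local Open Scope ring_scope.
Local Open Scope quotient_scope.

(** * Measure theory on a space with a distance *)

(* The constructions below take the distance as a bare function
   [d : T -> T -> R].  They are applied to a metric graph and then to [W2] of
   it.  An element of [W2] is a set function, and its values off the Borel sets
   are irrelevant, so on [W2] the distance separates points only up to equality
   on Borel sets.  This affects neither its open sets nor its Borel
   sigma-algebra. *)
Section distance_space.
Context {R : realType} {T : pointedType} (d : T -> T -> R).

Definition metric_open : set (set T) :=
  [set U | forall x, U x ->
     exists2 e : R, 0 < e & forall y, d x y < e -> U y].

End distance_space.

Notation borel d := (g_sigma_algebraType (metric_open d)).

Section hausdorff_measure.
Context {R : realType} {T : pointedType} (d : T -> T -> R).

Definition diameter (A : set T) : \bar R :=
  maxe 0%E (ereal_sup [set (d z.1 z.2)%:E | z in A `*` A]).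

Definition hausdorff1_delta (delta : R) (A : set T) : \bar R :=
  ereal_inf [set (\sum_(0 <= i <oo) diameter (U i))%E |
    U in [set U : (set T)^nat |
            A `<=` \bigcup_i U i /\
            forall i, (diameter (U i) <= delta%:E)%E]].

(* No normalising constant: in dimension one this is Lebesgue measure on a
   segment. *)
Definition hausdorff1 (A : set (borel d)) : \bar R :=
  ereal_sup [set hausdorff1_delta delta A | delta in [set delta | 0 < delta]].

End hausdorff_measure.

Arguments hausdorff1 {R T} d A.

Section parts_of_a_measure.
Context {disp : measure_display} {T : measurableType disp} {R : realType}.

Definition atomic_part (mu : {measure set T -> \bar R}) (A : set T) : \bar R :=
  \esum_(x in A) mu [set x].

Definition mutually_singular (nu : set T -> \bar R)
    (mu : {measure set T -> \bar R}) : Prop :=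
  exists N : set T, [/\ measurable N, nu N = 0 & mu (~` N) = 0]%E.

(* The Lebesgue decomposition [mu = a + s] with respect to [nu].  It determines
   [a] on measurable sets. *)
Definition is_ac_part (nu : set T -> \bar R)
    (mu a : {measure set T -> \bar R}) : Prop :=
  exists s : {measure set T -> \bar R},
    [/\ a `<< nu, mutually_singular nu s &
        forall A, measurable A -> mu A = (a A + s A)%E].

End parts_of_a_measure.

(** * The Wasserstein space *)

Section wasserstein.
Context {R : realType} {T : pointedType} (d : T -> T -> R).

Definition finite_second_moment (mu : probability (borel d) R) : Prop :=
  exists x0 : T, (\int[mu]_x (d x0 x ^+ 2)%:E < +oo)%E.

Record W2 : Type := MkW2 {
  W2_measure :> probability (borel d) R;
  W2_moment : finite_second_moment W2_measure }.

Definition coupling (mu nu : W2) :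
    set (probability (borel d * borel d)%type R) :=
  [set pi | forall A : set (borel d), measurable A ->
     pi (A `*` setT) = mu A /\ pi (setT `*` A) = nu A].

(* Squared distances between elements of [W2] are finite, so [fine] loses
   nothing; on a Polish space the infimum is a minimum. *)
Definition dW (mu nu : W2) : R :=
  Num.sqrt (fine (ereal_inf
    [set (\int[pi]_z (d z.1 z.2 ^+ 2)%:E)%E | pi in coupling mu nu])).

Section pointed.
Import HBNNSimple.

Lemma integral_dirac_lty (a : borel d) (f : borel d -> R) :
  (forall x, 0 <= f x) -> (\int[\d_a]_x (f x)%:E < +oo)%E.
Proof.
move=> f0; apply: (@le_lt_trans _ _ (f a)%:E); last exact: ltry.
rewrite ge0_integralTE; last by move=> x; rewrite lee_fin.
apply: ge_ereal_sup => _ [h /= hf <-].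
rewrite -integralT_nnsfun integral_dirac//.
  by rewrite diracT mul1e.
by apply/measurable_EFinP.
Qed.

Lemma dirac_finite_second_moment (a : borel d) :
  finite_second_moment (\d_a : probability (borel d) R).
Proof. by exists a; apply: integral_dirac_lty => x; exact: sqr_ge0. Qed.

End pointed.

HB.instance Definition _ := gen_eqMixin W2.
HB.instance Definition _ := gen_choiceMixin W2.
HB.instance Definition _ :=
  isPointed.Build W2 (MkW2 (dirac_finite_second_moment point)).

End wasserstein.

Arguments dW {R T} d mu nu.

Definition is_barycenter {R : realType} {T : pointedType} {d : T -> T -> R}
    (P : W2 (dW d)) (mu : W2 d) : Prop :=
  forall mu' : W2 d,
    (\int[P]_nu (dW d mu nu ^+ 2)%:E <= \int[P]_nu (dW d mu' nu ^+ 2)%:E)%E.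

(** * Metric graphs *)

(* An edge is an abstract label with a chosen orientation; [endpoints_inj]
   identifies the edges with a set of unordered pairs of distinct vertices.
   The vertex set is pointed because measurable types are. *)
Record metric_graph (R : realType) : Type := MetricGraph {
  vertex : pointedType;
  edge : choiceType;
  src : edge -> vertex;
  tgt : edge -> vertex;
  edge_length : edge -> R;
  vertex_countable : countable [set: vertex];
  no_loop : forall e, src e <> tgt e;
  endpoints_inj : injective (fun e => [set src e; tgt e]);
  graph_connected : forall v w : vertex, exists p : seq vertex,
    path (fun a b => `[< exists e, [set src e; tgt e] = [set a; b] >]) v p /\
    last v p = w;
  degree_finite : forall v, finite_set [set e | v = src e \/ v = tgt e];
  degree_ge1 : forall v, [set e | v = src e \/ v = tgt e] !=set0;
  edge_length_ge0 : forall e, 0 <= edge_length e;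
  edge_length_inf : 0 < inf (range edge_length) }.

Section points.
Context {R : realType} (G : metric_graph R).

Lemma edge_length_gt0 (e : edge G) : 0 < edge_length e.
Proof.
apply: (lt_le_trans (edge_length_inf G)).
apply: ge_inf; last by exists e.
by exists 0 => _ [f _ <-]; exact: edge_length_ge0.
Qed.

(* The disjoint union of the segments [0, l(e)]. *)
Definition segment_point : Type :=
  {p : edge G * R | (0 <= p.2) && (p.2 <= edge_length p.1)}.

HB.instance Definition _ := Choice.on segment_point.

Definition on_edge (p : segment_point) : edge G := (val p).1.
Definition coord (p : segment_point) : R := (val p).2.

Definition represents (p : segment_point) (v : vertex G) : Prop :=
  (coord p = 0 /\ v = src (on_edge p)) \/
  (coord p = edge_length (on_edge p) /\ v = tgt (on_edge p)).

Definition glued (p q : segment_point) : bool :=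
  (p == q) || `[< exists v, represents p v /\ represents q v >].

Lemma represents_uniq p v w : represents p v -> represents p w -> v = w.
Proof.
have l0 := edge_length_gt0 (on_edge p).
move=> [[c ->]|[c ->]] [[c' ->]|[c' ->]] //.
- by move: l0; rewrite -c' c ltxx.
- by move: l0; rewrite -c c' ltxx.
Qed.

Lemma glued_refl : reflexive glued.
Proof. by move=> p; rewrite /glued eqxx. Qed.

Lemma glued_sym : symmetric glued.
Proof.
move=> p q; rewrite /glued eq_sym; congr (_ || _).
by apply: asbool_equiv_eq; split=> -[v [? ?]]; exists v.
Qed.

Lemma glued_trans : transitive glued.
Proof.
move=> q p r /orP[/eqP -> //|/asboolP[v [pv qv]]].
move=> /orP[/eqP <-|/asboolP[w [qw rw]]].
  by apply/orP; right; apply/asboolP; exists v.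
apply/orP; right; apply/asboolP; exists v; split => //.
by rewrite (represents_uniq qv qw).
Qed.

Canonical glued_equiv := EquivRel glued glued_refl glued_sym glued_trans.

Definition point_of : Type := {eq_quot glued_equiv}.

HB.instance Definition _ := Choice.on point_of.
HB.instance Definition _ := EqQuotient.on point_of.

Lemma segment_start_subproof (e : edge G) :
  (0 <= (e, 0 : R).2) && ((e, 0 : R).2 <= edge_length (e, 0 : R).1).
Proof. by rewrite /= lexx edge_length_ge0. Qed.

Definition segment_start (e : edge G) : segment_point :=
  exist _ (e, 0) (segment_start_subproof e).

Definition base_point : point_of :=
  \pi_point_of (segment_start (projT1 (cid (degree_ge1 (point : vertex G))))).

HB.instance Definition _ := isPointed.Build point_of base_point.

(* [is_path x s y]: the segments of edges in [s], each given by its two ends,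
   concatenate to a path from [x] to [y]. *)
Fixpoint is_path (x : point_of) (s : seq (segment_point * segment_point))
    (y : point_of) : Prop :=
  if s is (p, q) :: s' then
    [/\ x = \pi_point_of p, on_edge p = on_edge q &
        is_path (\pi_point_of q) s' y]
  else x = y.

Definition path_length (s : seq (segment_point * segment_point)) : R :=
  \sum_(pq <- s) `|coord pq.1 - coord pq.2|.

Definition graph_dist (x y : point_of) : R :=
  inf [set path_length s | s in [set s | is_path x s y]].

End points.

Arguments graph_dist {R} G x y.

(* Main.v *)
Require Import Defs.
From mathcomp Require Import all_boot all_order all_algebra.
From mathcomp Require Import all_classical all_reals all_analysis.
From HB Require Import structures.
From mathcomp Require Import measurable_realfun ring lra.
Import Order.TTheory GRing.Theory Num.Theory.
Import numFieldNormedType.Exports.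
(* Here [coord] is the coordinate of a point of an edge, not the coordinate of
   a vector in a basis. *)
Import Defs.

Set Implicit Arguments.
Unset Strict Implicit.
Unset Printing Implicit Defensive.

Local Open Scope classical_set_scope.
Local Open Scope ring_scope.
Local Open Scope quotient_scope.

(** A barycenter fails to be unique because geodesics do.  On the lollipop graph
    (a cycle of length 4 through [root] and the opposite point [fork], and a
    stick of length 1 attached at [fork]) the point of the stick at distance
    [t] from [fork] is joined to [root] by two geodesics of length [2 + t], one
    along each arc of the cycle.  Their midpoints lie on different arcs.  Take
    any measure [nu] on the stick and give mass 1/2 to the Dirac mass at [root]
    and mass 1/2 to [nu].  The image of [nu] by either of the two midpoint maps
    is a barycenter ([midpoint_barycenter], [midpoint_is_barycenter]).  The two
    images are separated by the open ball of radius 1 around a vertex of one of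
    the arcs ([near_side_midpoint], [not_near_side_midpoint]).  If [nu] is the
    Dirac mass at [fork], both images are atoms.  If [nu] is uniform, both are
    absolutely continuous ([uniform_law_dominated]), since the curve of
    midpoints expands parameters by a constant factor, so that covers of a set
    of midpoints give covers of the set of parameters.

    That the images are barycenters is proved without gluing couplings.  An
    upper bound on their cost comes from the explicit couplings given by the
    parameter.  The lower bound, for an arbitrary competitor, comes from the
    easy half of Kantorovich duality ([kantorovich_le]) applied to functions of
    the distance to [root].  Duality also shows that the integral of a bounded
    Lipschitz function is a Borel function on the Wasserstein space
    ([Rintegral_measurable]); so the lower bounds can be integrated exactly,
    while measurability of the squared Wasserstein distance is not needed.

    Lower bounds on distances in the graph come from functions which are affine
    of slope at most 1 on each edge ([interpolate_lipschitz]). *)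

(** * Metric graphs *)

Section clamp.
Context {R : realType}.

(** The projection of the real line to the interval [0, l]. *)
Definition clamp (l c : R) : R := Num.max 0 (Num.min l c).

Lemma clamp_itv l c : 0 <= l -> 0 <= clamp l c <= l.
Proof. by move=> l0; rewrite /clamp le_max lexx/= ge_max l0 ge_min lexx. Qed.

Lemma clamp_id l c : 0 <= c <= l -> clamp l c = c.
Proof. by move=> /andP[c0 cl]; rewrite /clamp (min_idPr cl) (max_idPr c0). Qed.

Lemma clamp_lipschitz l s t : `|clamp l s - clamp l t| <= `|s - t|.
Proof.
rewrite /clamp /Num.max /Num.min; repeat case: ifPn; rewrite -?leNgt => *;
rewrite real_ler_norml ?num_real//; have := ler_norm (s - t);
have := lerNnormlW (lexx `|s - t|); lra.
Qed.

End clamp.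

Section graph_distance.
Context {R : realType} (G : metric_graph R).
Implicit Types (x y z : point_of G) (p q : segment_point G) (e : edge G).
Local Notation dist := (graph_dist G).

Lemma pi_represents p q v :
  represents p v -> represents q v -> \pi_(point_of G) p = \pi_(point_of G) q.
Proof.
move=> pv qv; apply/(eqmodP (glued_equiv G)); apply/orP; right.
by apply/asboolP; exists v.
Qed.

Lemma edge_point_subproof e (c : R) :
  let p := (e, clamp (edge_length e) c) in
  (0 <= p.2) && (p.2 <= edge_length p.1).
Proof. exact: clamp_itv (edge_length_ge0 e). Qed.

(** The point at distance [c] from the source of [e], with [c] projected to
    the interval [0, l(e)] so that the map is total; [on_graph] is its class in
    the quotient. *)
Definition edge_point e (c : R) : segment_point G :=
  exist _ (e, clamp (edge_length e) c) (edge_point_subproof e c).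

Definition on_graph e (c : R) : point_of G := \pi_(point_of G) (edge_point e c).

Lemma coord_edge_point e (c : R) : 0 <= c <= edge_length e ->
  coord (edge_point e c) = c.
Proof. exact: clamp_id. Qed.

Lemma edge_point_coord p : edge_point (on_edge p) (coord p) = p.
Proof.
apply: val_inj => /=.
by rewrite (clamp_id (valP p)) -surjective_pairing.
Qed.

Lemma on_graph_surj x :
  exists e (c : R), 0 <= c <= edge_length e /\ x = on_graph e c.
Proof.
exists (on_edge (repr x)), (coord (repr x)); split.
  by rewrite /coord /on_edge; case: (repr x).
by rewrite /on_graph edge_point_coord reprK.
Qed.

Lemma represents_src e : represents (edge_point e 0) (src e).
Proof. by left; rewrite coord_edge_point// lexx edge_length_ge0. Qed.

Lemma represents_tgt e : represents (edge_point e (edge_length e)) (tgt e).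
Proof. by right; rewrite coord_edge_point// lexx edge_length_ge0. Qed.

Lemma on_graph_src e f : src e = src f -> on_graph e 0 = on_graph f 0.
Proof.
by move=> ef; apply: (pi_represents (represents_src e)); rewrite ef;
  exact: represents_src.
Qed.

Lemma on_graph_tgt e f :
  tgt e = src f -> on_graph e (edge_length e) = on_graph f 0.
Proof.
by move=> ef; apply: (pi_represents (represents_tgt e)); rewrite ef;
  exact: represents_src.
Qed.

Lemma is_path_cat x y z s s' :
  is_path x s y -> is_path y s' z -> is_path x (s ++ s') z.
Proof.
elim: s x => [x /= -> //|[p q] s IH x /= [-> pq sy] ?].
by split=> //; exact: IH.
Qed.

Lemma path_length_cat (s s' : seq (segment_point G * segment_point G)) :
  path_length (s ++ s') = path_length s + path_length s'.
Proof. exact: big_cat. Qed.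

Lemma is_path_rev x y s : is_path x s y ->
  exists2 s', is_path y s' x & path_length s' = path_length s.
Proof.
elim: s x => [x /= ->|[p q] s IH x /= [-> pq /IH[s' ys' s's]]].
  by exists [::].
exists (s' ++ [:: (q, p)]); first exact: (is_path_cat ys').
rewrite path_length_cat s's /path_length big_seq1 [RHS]big_cons/=.
by rewrite distrC addrC.
Qed.

Lemma path_length_ge0 (s : seq (segment_point G * segment_point G)) :
  0 <= path_length s.
Proof. by apply: sumr_ge0 => i _; exact: normr_ge0. Qed.

Lemma path_to_src p :
  exists s, is_path (\pi_(point_of G) p) s (on_graph (on_edge p) 0).
Proof. by exists [:: (p, edge_point (on_edge p) 0)]; split. Qed.

(** A chain of adjacent vertices lifts to a path in the metric graph. *)
Lemma lift_vertex_path (v : vertex G) (s : seq (vertex G)) p :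
  path (fun a b => `[< exists e, [set src e; tgt e] = [set a; b] >]) v s ->
  represents p v ->
  exists q s', represents q (last v s) /\
    is_path (\pi_(point_of G) p) s' (\pi_(point_of G) q).
Proof.
elim: s v p => [|w s IH] v p /=; first by move=> _ pv; exists p, [::].
move=> /andP[/asboolP[e evw] ws] pv.
have [p1 [p2 [p1v p2w p12]]] : exists p1 p2,
    [/\ represents p1 v, represents p2 w & on_edge p1 = on_edge p2].
  have vs : [set src e; tgt e] v by rewrite evw; left.
  have : [set v; w] (src e) by rewrite -evw; left.
  have : [set v; w] (tgt e) by rewrite -evw; right.
  move: (@no_loop _ G e) => se.
  case=> [tv|tw]; case=> [sv|sw].
  - by case: se; rewrite sv tv.
  - rewrite -tv -sw; exists (edge_point e (edge_length e)), (edge_point e 0).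
    by split=> //; [exact: represents_tgt|exact: represents_src].
  - rewrite -tw -sv; exists (edge_point e 0), (edge_point e (edge_length e)).
    by split=> //; [exact: represents_src|exact: represents_tgt].
  - by case: se; rewrite sw tw.
have [q [s' [qs p2s'q]]] := IH _ _ ws p2w.
exists q, ((p1, p2) :: s'); split=> //=; split=> //.
exact: pi_represents pv p1v.
Qed.

Lemma path_connected x y : exists s, is_path x s y.
Proof.
rewrite -(reprK x) -(reprK y); set p := repr x; set q := repr y.
have [s1 ps1] := path_to_src p.
have [s3 qs3] := path_to_src q.
have [s3' qs3' _] := is_path_rev qs3.
have [s [sp sl]] := graph_connected (src (on_edge p)) (src (on_edge q)).
have [r [s2 [rl ps2]]] := lift_vertex_path sp (represents_src _).
exists (s1 ++ s2 ++ s3'); apply: is_path_cat ps1 _.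
apply: is_path_cat ps2 _.
rewrite sl in rl; rewrite (pi_represents rl (represents_src _)).
exact: qs3'.
Qed.

Lemma graph_dist_has_inf x y :
  has_inf [set path_length s | s in [set s | is_path x s y]].
Proof.
have [s xsy] := path_connected x y; split.
  by exists (path_length s), s.
by exists 0 => _ [s' _ <-]; exact: path_length_ge0.
Qed.

Lemma graph_dist_le x y s : is_path x s y -> dist x y <= path_length s.
Proof.
move=> xsy; apply: ge_inf; last by exists s.
by case: (graph_dist_has_inf x y).
Qed.

Lemma graph_dist_ge x y r :
  (forall s, is_path x s y -> r <= path_length s) -> r <= dist x y.
Proof.
move=> h; apply: lb_le_inf; first by case: (graph_dist_has_inf x y).
by move=> _ [s xsy <-]; exact: h.
Qed.

Lemma graph_dist_ge0 x y : 0 <= dist x y.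
Proof. by apply: graph_dist_ge => s _; exact: path_length_ge0. Qed.

Lemma graph_distxx x : dist x x = 0.
Proof.
apply/eqP; rewrite eq_le graph_dist_ge0 andbT.
have /graph_dist_le : is_path x [::] x by [].
by rewrite /path_length big_nil.
Qed.

Lemma graph_distC x y : dist x y = dist y x.
Proof.
suff h a b : dist a b <= dist b a by apply/eqP; rewrite eq_le !h.
apply: graph_dist_ge => s /is_path_rev[s' as'b <-].
exact: graph_dist_le.
Qed.

Lemma graph_dist_triangle y x z : dist x z <= dist x y + dist y z.
Proof.
rewrite -lerBlDr; apply: graph_dist_ge => s xsy.
rewrite lerBlDr -lerBlDl; apply: graph_dist_ge => s' ys'z.
rewrite lerBlDl -path_length_cat; apply: graph_dist_le.
exact: is_path_cat ys'z.
Qed.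

(** Projecting a coordinate to an edge does not increase distances, so the bound
   needs no condition on [c] and [c']. *)
Lemma graph_dist_on_graph e (c c' : R) :
  dist (on_graph e c) (on_graph e c') <= `|c - c'|.
Proof.
have /graph_dist_le/le_trans : is_path (on_graph e c)
  [:: (edge_point e c, edge_point e c')] (on_graph e c') by split.
by apply; rewrite /path_length big_seq1; exact: clamp_lipschitz.
Qed.

(** The function on the graph which equals [g] at the vertices and is affine
    along each edge. *)
Definition interpolate (g : vertex G -> R) x : R :=
  let p := repr x in let e := on_edge p in
  g (src e) + (g (tgt e) - g (src e)) * (coord p / edge_length e).

Lemma interpolate_pi (g : vertex G -> R) p :
  interpolate g (\pi_(point_of G) p) = g (src (on_edge p)) +
    (g (tgt (on_edge p)) - g (src (on_edge p))) *
      (coord p / edge_length (on_edge p)).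
Proof.
have vertexE q v : represents q v -> g (src (on_edge q)) +
    (g (tgt (on_edge q)) - g (src (on_edge q))) *
      (coord q / edge_length (on_edge q)) = g v.
  case=> -[-> ->]; first by rewrite mul0r mulr0 addr0.
  by rewrite divff ?mulr1 ?subrKC// gt_eqF// edge_length_gt0.
have /(eqmodP (glued_equiv G)) :
    repr (\pi_(point_of G) p) = p %[mod {eq_quot (glued_equiv G)}].
  exact: reprK.
move=> /orP[/eqP|/asboolP[v [rv pv]]]; first by rewrite /interpolate => ->.
by rewrite /interpolate !(vertexE _ v).
Qed.

Lemma interpolate_on_graph (g : vertex G -> R) e (c : R) :
  0 <= c <= edge_length e ->
  interpolate g (on_graph e c) =
  g (src e) + (g (tgt e) - g (src e)) * (c / edge_length e).
Proof. by move=> cl; rewrite interpolate_pi coord_edge_point. Qed.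

(** A function with slopes at most 1 in absolute value changes along a path by
    at most the length of the path. *)
Lemma interpolate_lipschitz (g : vertex G -> R) x y :
  (forall e, `|g (tgt e) - g (src e)| <= edge_length e) ->
  `|interpolate g x - interpolate g y| <= dist x y.
Proof.
move=> gl; apply: graph_dist_ge => s.
elim: s x => [x /= ->|[p q] s IH x /= [-> pq /IH {}IH]].
  by rewrite subrr normr0 path_length_ge0.
rewrite /path_length big_cons -/(path_length s).
apply: le_trans (ler_distD (interpolate g (\pi_(point_of G) q)) _ _) _.
apply: lerD IH => /=; rewrite !interpolate_pi pq.
set e := on_edge q; have l0 := edge_length_gt0 e.
rewrite opprD addrACA subrr add0r -mulrBr -mulrBl mulrCA normrM.
rewrite ler_piMr// normrM normfV (gtr0_norm l0).
by rewrite ler_pdivrMr// mul1r.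
Qed.

End graph_distance.

(** * Integration of bounded or nonnegative functions *)

Section monotone_integral.
Context {disp : measure_display} {S : measurableType disp} {R : realType}.
Variable mu : {measure set S -> \bar R}.
Import HBNNSimple.

(** The integral of a nonnegative function is a supremum over the simple
    functions below it.  Hence it is monotone, and its value for an image
    measure is at most the integral of the composite, for arbitrary functions.
    This matters for the transport cost, which is not known to be measurable
    for the product of the Borel sigma-algebras, and for the squared distance
    to a point of the Wasserstein space. *)
Lemma le_nonmeasurable_integral (f g : S -> \bar R) :
  (forall x, 0 <= f x)%E -> (forall x, f x <= g x)%E ->
  (\int[mu]_x f x <= \int[mu]_x g x)%E.
Proof.
move=> f0 fg; rewrite !ge0_integralTE//; last first.
  by move=> x; exact: le_trans (fg x).
by apply: ereal_sup_le => _ [h hf <-]; exists h => // x; exact: le_trans (fg x).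
Qed.

Lemma nonmeasurable_pushforward_le {disp' : measure_display}
    {S' : measurableType disp'} (X : {mfun S >-> S'}) (f : S' -> \bar R) :
  (forall x, 0 <= f x)%E ->
  (\int[pushforward mu X]_x f x <= \int[mu]_x f (X x))%E.
Proof.
move=> f0; rewrite [leLHS]ge0_integralTE//; apply: ge_ereal_sup => _ [h hf <-].
rewrite -integralT_nnsfun ge0_integral_pushforward//=; last 2 first.
  exact/measurable_EFinP.
  by move=> y _; rewrite lee_fin.
rewrite preimage_setT; apply: le_nonmeasurable_integral => x /=.
  by rewrite lee_fin.
exact: hf.
Qed.

End monotone_integral.

Section bounded_functions.
Context {disp : measure_display} {S : measurableType disp} {R : realType}.
Variable mu : probability S R.

(** Bounded measurable functions, which are integrable for a probability. *)
Definition bounded_measurable (f : S -> R) : Prop :=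
  measurable_fun [set: S] f /\ exists M : R, forall x, `|f x| <= M.

Lemma bounded_measurable_integrable (f : S -> R) :
  bounded_measurable f -> mu.-integrable setT (EFin \o f).
Proof.
move=> [mf [M fM]]; apply: measurable_bounded_integrable => //.
  exact: le_lt_trans (probability_le1 mu measurableT) (ltry 1).
exists M; split; first exact: num_real.
by move=> y My x _; exact: le_trans (fM x) (ltW My).
Qed.

Lemma EFin_Rintegral (f : S -> R) :
  bounded_measurable f -> (\int[mu]_x f x)%:E = (\int[mu]_x (f x)%:E)%E.
Proof.
move=> bf; rewrite /Rintegral fineK//; apply: integrable_fin_num => //.
exact: bounded_measurable_integrable.
Qed.

Lemma integral_cst_probability (c : R) : (\int[mu]_x c%:E = c%:E)%E.
Proof.
rewrite integral_cst//; have /= -> := probability_setT mu.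
by rewrite mule1.
Qed.

Lemma bounded_measurable_cst (c : R) : bounded_measurable (fun=> c).
Proof. by split=> //; exists `|c|. Qed.

Lemma bounded_measurableD (f g : S -> R) : bounded_measurable f ->
  bounded_measurable g -> bounded_measurable (fun x => f x + g x).
Proof.
move=> [mf [M fM]] [mg [N gN]]; split; first exact: measurable_funD.
by exists (M + N) => x; exact: le_trans (ler_normD _ _) (lerD (fM x) (gN x)).
Qed.

Lemma bounded_measurableM (f g : S -> R) : bounded_measurable f ->
  bounded_measurable g -> bounded_measurable (fun x => f x * g x).
Proof.
move=> [mf [M fM]] [mg [N gN]]; split; first exact: measurable_funM.
by exists (M * N) => x; rewrite normrM ler_pM.
Qed.

Lemma bounded_measurableX (f : S -> R) n : bounded_measurable f ->
  bounded_measurable (fun x => f x ^+ n).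
Proof.
move=> [mf [M fM]]; split; first exact: measurable_funX.
by exists (M ^+ n) => x; rewrite normrX lerXn2r// ?nnegrE// (le_trans _ (fM x)).
Qed.

End bounded_functions.

Lemma bounded_measurable_comp (R : realType) (disp disp' : measure_display)
    (S : measurableType disp) (S' : measurableType disp')
    (X : S' -> S) (f : S -> R) : measurable_fun setT X ->
  bounded_measurable f -> bounded_measurable (f \o X).
Proof.
move=> mX [mf [M fM]]; split; first exact: measurableT_comp.
by exists M => x; exact: fM.
Qed.

(** * Wasserstein distance for a bounded distance *)

Section borel_measurability.
Context {R : realType} {T : pointedType} (d : T -> T -> R).

Lemma metric_open_measurable (U : set T) :
  metric_open d U -> measurable (U : set (borel d)).
Proof. by move=> oU; exact: sub_sigma_algebra. Qed.

Lemma metric_lsc_measurable (f : T -> R) :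
  (forall r, metric_open d [set x | r < f x]) ->
  measurable_fun [set: borel d] (f : borel d -> R).
Proof.
move=> h; apply: (measurability _ (RGenOInfty.measurableE R)).
move=> _ [_ [r ->] <-]; rewrite setTI.
rewrite [X in measurable X](_ : _ = [set x | r < f x]).
  exact: metric_open_measurable.
by apply/seteqP; split => x /=; rewrite in_itv/= andbT.
Qed.

Lemma lipschitz_measurable (f : T -> R) :
  (forall x y, `|f x - f y| <= d x y) ->
  measurable_fun [set: borel d] (f : borel d -> R).
Proof.
move=> fl; apply: metric_lsc_measurable => r x /= rx.
exists (f x - r); first by rewrite subr_gt0.
move=> y dxy; have := le_lt_trans (le_trans (ler_norm _) (fl x y)) dxy.
by rewrite ltrD2l ltrN2.
Qed.

Lemma curve_measurable (g : R -> T) :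
  (forall s t, d (g s) (g t) <= `|s - t|) ->
  measurable_fun [set: measurableTypeR R] (g : measurableTypeR R -> borel d).
Proof.
move=> gl; apply: (@measurability _ _ _ (borel d) _ _ (metric_open d)) => //.
move=> _ [U oU <-]; rewrite setTI; apply: open_measurable.
rewrite openE => s /= /oU[e e0 eU]; apply/nbhs_ballP; exists e => //= t st.
by apply: eU; apply: le_lt_trans (gl _ _) _.
Qed.

End borel_measurability.

Section bounded_wasserstein.
Context {R : realType} {T : pointedType} (d : T -> T -> R) (D : R).
Hypothesis d_ge0 : forall x y, 0 <= d x y.
Hypothesis d_le : forall x y, d x y <= D.
Implicit Types mu nu : W2 d.

Let sqr_d_ge0 (z : borel d * borel d) : (0 <= (d z.1 z.2 ^+ 2)%:E)%E.
Proof. by rewrite lee_fin sqr_ge0. Qed.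

Let sqr_d_le x y : d x y ^+ 2 <= D ^+ 2.
Proof. by rewrite lerXn2r ?nnegrE// (le_trans (d_ge0 x y)). Qed.

Lemma bounded_second_moment (mu : probability (borel d) R) :
  finite_second_moment mu.
Proof.
exists point; apply: (@le_lt_trans _ _ (\int[mu]_x (D ^+ 2)%:E)%E).
  by apply: le_nonmeasurable_integral => x; rewrite lee_fin ?sqr_ge0.
by rewrite integral_cst_probability ltry.
Qed.

Lemma transport_cost_le (pi : probability (borel d * borel d)%type R) :
  (\int[pi]_z (d z.1 z.2 ^+ 2)%:E <= (D ^+ 2)%:E)%E.
Proof.
apply: (@le_trans _ _ (\int[pi]_x (D ^+ 2)%:E)%E).
  by apply: le_nonmeasurable_integral => z; rewrite lee_fin ?sqr_ge0.
by rewrite integral_cst_probability.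
Qed.

Let costs mu nu : set \bar R :=
  [set (\int[pi]_z (d z.1 z.2 ^+ 2)%:E)%E | pi in coupling mu nu].

Lemma product_coupling mu nu : coupling mu nu (mu \x nu)%E.
Proof.
move=> A mA; split.
  apply: etrans (product_measure1E mu nu mA measurableT) _.
  by have /= -> := probability_setT nu; rewrite mule1.
apply: etrans (product_measure1E mu nu measurableT mA) _.
by have /= -> := probability_setT mu; rewrite mul1e.
Qed.

Let costs_ge0 mu nu : (0 <= ereal_inf (costs mu nu))%E.
Proof.
apply: le_ereal_inf_tmp => _ [pi _ <-].
by apply: integral_ge0 => z _; rewrite lee_fin sqr_ge0.
Qed.

Let costs_le mu nu : (ereal_inf (costs mu nu) <= (D ^+ 2)%:E)%E.
Proof.
apply: ge_ereal_inf; exists (\int[(mu \x nu)%E]_z (d z.1 z.2 ^+ 2)%:E)%E.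
  by exists (mu \x nu)%E => //; exact: product_coupling.
exact: transport_cost_le.
Qed.

Let costs_fin mu nu : ereal_inf (costs mu nu) \is a fin_num.
Proof.
rewrite ge0_fin_numE//; exact: le_lt_trans (costs_le mu nu) (ltry _).
Qed.

Lemma EFin_sqr_dW mu nu : ((dW d mu nu ^+ 2)%:E = ereal_inf (costs mu nu))%E.
Proof.
rewrite /dW sqr_sqrtr; last exact/fine_ge0/costs_ge0.
by rewrite fineK//; exact: costs_fin.
Qed.

Lemma dW_ge0 mu nu : 0 <= dW d mu nu. Proof. exact: sqrtr_ge0. Qed.

Lemma sqr_dW_le_diameter mu nu : dW d mu nu ^+ 2 <= D ^+ 2.
Proof.
rewrite -lee_fin EFin_sqr_dW.
exact: costs_le.
Qed.

(** The easy half of Kantorovich duality. *)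
Lemma kantorovich_le mu nu (phi psi : borel d -> R) :
  bounded_measurable phi -> bounded_measurable psi ->
  (forall x y, phi x + psi y <= d x y ^+ 2) ->
  \int[mu]_x phi x + \int[nu]_y psi y <= dW d mu nu ^+ 2.
Proof.
move=> bphi bpsi h; rewrite -lee_fin EFin_sqr_dW.
apply: le_ereal_inf_tmp => _ [pi pimunu <-].
have b1 : bounded_measurable (fun z : borel d * borel d => phi z.1).
  exact: (bounded_measurable_comp measurable_fst bphi).
have b2 : bounded_measurable (fun z : borel d * borel d => psi z.2).
  exact: (bounded_measurable_comp measurable_snd bpsi).
have -> : \int[mu]_x phi x = \int[pi]_z phi z.1.
  congr fine; rewrite -(@integral_pushforward _ _ _ _ _ _ measurable_fst pi setT
    (EFin \o phi))//; last 2 first.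
  - by apply/measurable_EFinP; case: bphi.
  - rewrite preimage_setT.
    exact: (bounded_measurable_integrable pi b1).
  apply: eq_measure_integral => A mA _; have [e _] := pimunu A mA.
  apply: etrans (esym e) _.
  by rewrite /pushforward; congr (pi _); apply/seteqP; split => -[? ?] //= [].
have -> : \int[nu]_x psi x = \int[pi]_z psi z.2.
  congr fine; rewrite -(@integral_pushforward _ _ _ _ _ _ measurable_snd pi setT
    (EFin \o psi))//; last 2 first.
  - by apply/measurable_EFinP; case: bpsi.
  - rewrite preimage_setT.
    exact: (bounded_measurable_integrable pi b2).
  apply: eq_measure_integral => A mA _; have [_ e] := pimunu A mA.
  apply: etrans (esym e) _.
  by rewrite /pushforward; congr (pi _); apply/seteqP; split => -[? ?] //= [].
rewrite -RintegralD//; [|exact: bounded_measurable_integrable..].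
rewrite EFin_Rintegral; last exact: bounded_measurableD.
(* Monotonicity without measurability is only available for nonnegative
   functions, hence the detour through the positive part. *)
apply: (@le_trans _ _ (\int[pi]_z (Num.max 0 (phi z.1 + psi z.2))%:E)%E).
  have bf := bounded_measurableD b1 b2.
  apply: le_integral => //.
  - exact: (bounded_measurable_integrable pi bf).
  - apply: (bounded_measurable_integrable pi); case: bf => ? [M fM]; split.
      exact: measurable_maxr.
    exists M => z; apply: le_trans (fM z).
    by rewrite /Num.max; case: ifP => _ //; rewrite normr0.
  - by move=> z _; rewrite lee_fin le_max lexx orbT.
apply: le_nonmeasurable_integral => z; rewrite lee_fin ?le_max ?lexx//.
by rewrite ge_max sqr_ge0 h.
Qed.

Section laws.
Context {disp : measure_display} {S : measurableType disp}.
Variable P : probability S R.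

(** The law of a random point, as an element of the Wasserstein space: it has
    a finite second moment since the distance is bounded. *)
Definition law (X : {mfun S >-> borel d}) : W2 d :=
  MkW2 (bounded_second_moment (distribution P X)).

(** The joint law of [X] and [Y] is a coupling of their laws. *)
Lemma sqr_dW_law_le (X Y : {mfun S >-> borel d}) (c : S -> R) :
  bounded_measurable c -> (forall t, d (X t) (Y t) <= c t) ->
  dW d (law X) (law Y) ^+ 2 <= \int[P]_t (c t ^+ 2).
Proof.
move=> bc XYc; rewrite -lee_fin EFin_sqr_dW EFin_Rintegral; last first.
  exact: bounded_measurableX.
have mXY : measurable_fun setT (fun t => (X t, Y t)).
  exact: measurable_fun_pair.
pose XY : {mfun S >-> (borel d * borel d)%type} :=
  HB.pack (fun t => (X t, Y t)) (isMeasurableFun.Build _ _ _ _ _ mXY).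
apply: ge_ereal_inf; exists (\int[distribution P XY]_z (d z.1 z.2 ^+ 2)%:E)%E.
  exists (distribution P XY) => // A mA; split.
    by congr (P _); apply/seteqP; split => t //= [].
  by congr (P _); apply/seteqP; split => t //= [].
apply: le_trans (nonmeasurable_pushforward_le _ _ sqr_d_ge0) _.
apply: le_nonmeasurable_integral => t; rewrite lee_fin ?sqr_ge0//=.
by rewrite lerXn2r ?nnegrE// (le_trans (d_ge0 _ _) (XYc t)).
Qed.

Lemma Rintegral_law (X : {mfun S >-> borel d}) (f : borel d -> R) :
  bounded_measurable f -> \int[law X]_x f x = \int[P]_t f (X t).
Proof.
move=> bf; congr fine; rewrite integral_pushforward//.
- by apply/measurable_EFinP; case: bf.
- rewrite preimage_setT.
  exact: (bounded_measurable_integrable P (bounded_measurable_comp _ bf)).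
Qed.

End laws.

(** Integration of a fixed bounded Lipschitz function is a Borel function on
    the Wasserstein space. *)
Lemma Rintegral_measurable (f : borel d -> R) (K : R) : 0 < K ->
  bounded_measurable f -> (forall x y, f x - f y <= K * d x y) ->
  measurable_fun [set: borel (dW d)] (fun nu : borel (dW d) => \int[nu]_x f x).
Proof.
move=> K0 bf fK; apply: metric_lsc_measurable => r nu /= rnu.
(* From c (K s - e) <= s ^ 2 for c = 4 e / K ^ 2, duality bounds the difference
   of the two integrals by e + (dW nu nu') ^ 2 / c. *)
pose e := (\int[nu]_x f x - r) / 2; pose c := 4 * e / K ^+ 2.
have e0 : 0 < e by rewrite divr_gt0// subr_gt0.
have c0 : 0 < c by apply: divr_gt0; [exact: mulr_gt0|exact: exprn_gt0].
exists (Num.sqrt (c * e)); first by rewrite sqrtr_gt0 mulr_gt0.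
move=> nu'; rewrite -ltr_sqr ?nnegrE ?sqrtr_ge0 ?dW_ge0//.
rewrite (sqr_sqrtr (ltW (mulr_gt0 c0 e0))) => dnu /=.
have bcf (k : R) : bounded_measurable (fun x => k * f x).
  exact: bounded_measurableM (bounded_measurable_cst _) bf.
have bcst : bounded_measurable (fun _ : borel d => - (c * e)).
  exact: bounded_measurable_cst.
have := kantorovich_le nu nu' (bcf c) (bounded_measurableD (bcf (- c)) bcst).
have -> : \int[nu']_x (- c * f x + - (c * e)) = - c * \int[nu']_x f x - c * e.
  rewrite RintegralD//; last 2 first.
  - exact: (bounded_measurable_integrable nu' (bcf _)).
  - exact: (bounded_measurable_integrable nu' bcst).
  rewrite RintegralZl//; last exact: bounded_measurable_integrable.
  rewrite Rintegral_cst//; have /= -> := probability_setT nu'.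
  by rewrite mulr1.
rewrite RintegralZl//; last exact: bounded_measurable_integrable.
rewrite mulNr addrA -!mulrBr => dual.
have {dual}/dual : forall x y, c * f x + (- c * f y + - (c * e)) <= d x y ^+ 2.
  move=> x y; rewrite mulNr addrA -!mulrBr.
  apply: (@le_trans _ _ (c * (K * d x y - e))).
    by rewrite ler_pM2l// lerD2r.
  rewrite -subr_ge0 (_ : _ - _ = (d x y - 2 * e / K) ^+ 2) ?sqr_ge0// /c.
  by field; rewrite gt_eqF.
move=> /le_lt_trans/(_ dnu); rewrite ltr_pM2l// /e; lra.
Qed.

End bounded_wasserstein.

(** * Barycenters made of midpoints *)

Section midpoint_barycenters.
Context {R : realType} {T : pointedType} (d : T -> T -> R) (D : R).
Hypothesis d_ge0 : forall x y, 0 <= d x y.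
Hypothesis d_le : forall x y, d x y <= D.
Hypothesis dxx : forall x, d x x = 0.
Hypothesis dC : forall x y, d x y = d y x.
Hypothesis d_triangle : forall y x z, d x z <= d x y + d y z.

Let dW_le (mu nu : W2 d) : dW d mu nu <= D.
Proof.
rewrite -ler_sqr ?nnegrE ?dW_ge0//.
  exact: sqr_dW_le_diameter d_ge0 d_le _ _.
exact: le_trans (d_ge0 point point) (d_le _ _).
Qed.

Let select (nu0 nu1 : W2 d) (b : bool) : borel (dW d) :=
  if b then nu0 else nu1.

Let measurable_select (nu0 nu1 : W2 d) :
  measurable_fun [set: bool] (select nu0 nu1).
Proof. by []. Qed.

Let select_mfun (nu0 nu1 : W2 d) : {mfun bool >-> borel (dW d)} :=
  HB.pack (select nu0 nu1)
    (isMeasurableFun.Build _ _ _ _ _ (@measurable_select nu0 nu1)).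

(** The measure giving mass 1/2 to each of two points of the Wasserstein
    space. *)
Definition half_half (nu0 nu1 : W2 d) : W2 (dW d) :=
  law (@dW_ge0 _ _ d) dW_le (bernoulli_prob 2^-1) (select_mfun nu0 nu1).

Let half01 : 0 <= (2^-1 : R) <= 1.
Proof. by rewrite invr_ge0 ler0n/= invf_le1// ler1n. Qed.

Let half_halfE (f : W2 d -> \bar R) (nu0 nu1 : W2 d) :
  (forall nu, 0 <= f nu)%E ->
  (\int[bernoulli_prob 2^-1]_b f (select nu0 nu1 b) =
   (2^-1)%:E * (f nu0 + f nu1))%E.
Proof.
move=> f0; rewrite integral_bernoulli_prob// muleDr//; last first.
  by rewrite ge0_adde_def// inE.
by congr (_ + _ * _)%E; congr EFin; rewrite /unstable.onem; lra.
Qed.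

Lemma half_half_integral_le (f : W2 d -> \bar R) (nu0 nu1 : W2 d) :
  (forall nu, 0 <= f nu)%E ->
  (\int[half_half nu0 nu1]_nu f nu <= (2^-1)%:E * (f nu0 + f nu1))%E.
Proof.
move=> f0; rewrite -half_halfE//.
exact: (nonmeasurable_pushforward_le (bernoulli_prob 2^-1)
  (select_mfun nu0 nu1) f0).
Qed.

Lemma half_half_integral (f : W2 d -> \bar R) (nu0 nu1 : W2 d) :
  measurable_fun [set: borel (dW d)] (f : borel (dW d) -> \bar R) ->
  (forall nu, 0 <= f nu)%E ->
  (\int[half_half nu0 nu1]_nu f nu = (2^-1)%:E * (f nu0 + f nu1))%E.
Proof.
by move=> mf f0; rewrite -half_halfE// ge0_integral_pushforward.
Qed.

Context {disp : measure_display} {S : measurableType disp}.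
Variable P : probability S R.
Local Notation law := (law d_ge0 d_le P).

(** If [mid t] is always a midpoint of [x0] and [end_ t], then the law of [mid]
    is a barycenter of the Dirac mass at [x0] and the law of [end_].  With [F]
    the distance to [x0], optimality is certified by the inequalities
    [F z ^ 2 - 2 D F y <= d z y ^ 2] and [F y ^ 2 / 2 - F z ^ 2 <= d z y ^ 2],
    which through duality bound the squared distance to an arbitrary measure
    from below by a Borel function [G] on the Wasserstein space. *)
Lemma midpoint_barycenter (x0 : T) (mid end_ : {mfun S >-> borel d}) :
  (forall t, d (mid t) x0 <= d x0 (end_ t) / 2) ->
  (forall t, d (mid t) (end_ t) <= d x0 (end_ t) / 2) ->
  is_barycenter (half_half (law (cst (x0 : borel d))) (law end_)) (law mid).
Proof.
move=> mid0 mid1 mu'.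
set nu0 := law (cst _); set nu1 := law end_.
pose F : borel d -> R := d x0; pose q := \int[P]_t F (end_ t) ^+ 2.
have F_lip x y : F x - F y <= d x y.
  by rewrite lerBlDl (dC x) d_triangle.
have F_norm x y : `|F x - F y| <= d x y.
  by rewrite ler_norml F_lip andbT lerNl opprB dC F_lip.
have F_sqr x y : (F x - F y) ^+ 2 <= d x y ^+ 2.
  by rewrite -[leLHS]real_normK ?num_real// lerXn2r ?nnegrE.
have bF : bounded_measurable F.
  split; last by exists D => x; rewrite ger0_norm ?d_ge0 ?d_le.
  exact: lipschitz_measurable.
have bF2 : bounded_measurable (fun x => F x ^+ 2) by exact: bounded_measurableX.
have D0 : 0 <= D by exact: le_trans (d_ge0 x0 x0) (d_le _ _).
have bFend : bounded_measurable (fun t => F (end_ t)).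
  exact: (bounded_measurable_comp _ bF).
(* Both sides are compared with [q / 4]. *)
apply: (@le_trans _ _ (q / 4)%:E).
  have upper b : dW d (law mid) (if b then nu0 else nu1) ^+ 2 <= q / 4.
    have -> : q / 4 = \int[P]_t (F (end_ t) / 2) ^+ 2.
      rewrite /q mulrC -RintegralZl//; last first.
        exact: (bounded_measurable_integrable P (bounded_measurableX 2 bFend)).
      by apply: eq_Rintegral => t _; field.
    have bF' := bounded_measurableM bFend (bounded_measurable_cst 2^-1).
    by case: b; apply: (sqr_dW_law_le _ _ _ bF').
  apply: le_trans (half_half_integral_le _ _ _) _.
    by move=> nu; rewrite lee_fin sqr_ge0.
  rewrite -EFinD -EFinM lee_fin.
  by have := upper true; have := upper false => /= *; lra.
pose a := \int[mu']_x F x ^+ 2.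
pose G (nu : borel (dW d)) := Num.max 0 (Num.max
  (a - 2 * D * \int[nu]_x F x) (2^-1 * \int[nu]_x F x ^+ 2 - a)).
have mG : measurable_fun setT G.
  apply: measurable_maxr => //; apply: measurable_maxr.
    apply: measurable_funB => //; apply: measurable_funM => //.
    apply: (Rintegral_measurable d_ge0 d_le ltr01) => // x y.
    by rewrite mul1r F_lip.
  apply: measurable_funB => //; apply: measurable_funM => //.
  (* [F ^ 2] is Lipschitz of constant [2 D]; a positive constant is required. *)
  apply: (@Rintegral_measurable _ _ _ _ d_ge0 d_le _ (2 * D + 1)) => //.
    by rewrite ltr_wpDl// mulr_ge0.
  move=> x y; rewrite subr_sqr.
  have := F_lip x y; have := d_ge0 x y; have := d_le x0 x; have := d_le x0 y.
  have := d_ge0 x0 x; have := d_ge0 x0 y.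
  rewrite -/(F x) -/(F y) => *; nra.
have G_le nu : G nu <= dW d mu' nu ^+ 2.
  have bZ (k : R) (f : borel d -> R) : bounded_measurable f ->
      bounded_measurable (fun x : borel d => k * f x).
    by move=> bf; exact: bounded_measurableM (bounded_measurable_cst _) bf.
  rewrite !ge_max sqr_ge0/=; apply/andP; split.
    have := kantorovich_le d_ge0 d_le mu' nu bF2 (bZ (- (2 * D)) _ bF).
    rewrite RintegralZl//; last exact: bounded_measurable_integrable.
    rewrite mulNr; apply => z y.
    apply: le_trans (F_sqr z y).
    have : 0 <= (D - F z) * F y by rewrite mulr_ge0 ?d_ge0// subr_ge0 d_le.
    have := sqr_ge0 (F y); nra.
  have := kantorovich_le d_ge0 d_le mu' nu (bZ (- 1) _ bF2) (bZ 2^-1 _ bF2).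
  rewrite !RintegralZl//; [|exact: bounded_measurable_integrable..].
  rewrite mulN1r addrC; apply => z y.
  apply: le_trans (F_sqr z y).
  have := sqr_ge0 (F z - F y / 2); nra.
have EG : (\int[half_half nu0 nu1]_nu (G nu)%:E =
    (2^-1)%:E * ((G nu0)%:E + (G nu1)%:E))%E.
  apply: half_half_integral; first exact/measurable_EFinP.
  by move=> nu; rewrite lee_fin le_max lexx.
apply: (@le_trans _ _ (\int[half_half nu0 nu1]_nu (G nu)%:E)%E); last first.
  apply: le_nonmeasurable_integral => nu; rewrite lee_fin ?G_le//.
  by rewrite le_max lexx.
rewrite EG -EFinD -EFinM lee_fin.
have G0 : a <= G nu0.
  have F0 : \int[nu0]_x F x = 0.
    rewrite Rintegral_law//; transitivity (\int[P]_t (0 : R)).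
      by apply: eq_Rintegral => t _; exact: dxx.
    by rewrite Rintegral_cst// mul0r.
  by rewrite /G !le_max F0 mulr0 subr0 lexx orbT.
have G1 : q / 2 - a <= G nu1.
  have -> : q = \int[nu1]_x F x ^+ 2 by rewrite Rintegral_law.
  by rewrite /G !le_max (mulrC _ 2^-1) lexx !orbT.
by move: G0 G1; lra.
Qed.

End midpoint_barycenters.

(** * Absolute continuity with respect to Hausdorff measure *)

Section hausdorff_absolute_continuity.
Context {R : realType} {T : pointedType} (d : T -> T -> R).

Lemma diameter_ge0 (A : set T) : (0 <= diameter d A)%E.
Proof. by rewrite /diameter le_max lexx. Qed.

Lemma le_diameter (A : set T) x y :
  A x -> A y -> ((d x y)%:E <= diameter d A)%E.
Proof.
move=> Ax Ay; rewrite /diameter le_max; apply/orP; right.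
by apply: ereal_sup_ubound; exists (x, y).
Qed.

Lemma hausdorff1_set0 : hausdorff1 d set0 = 0%E.
Proof.
have diameter0 : diameter d set0 = 0%E.
  rewrite /diameter (_ : [set _ | _ in _] = set0) ?ereal_sup0 ?maxeNy//.
  by rewrite -subset0 => _ [z [[]]].
apply/eqP; rewrite eq_le; apply/andP; split.
  apply: ge_ereal_sup => _ [r /= r0 <-]; apply: ereal_inf_lbound.
  exists (fun=> set0); last by rewrite eseries0// => i _ _; rewrite diameter0.
  by split=> // i; rewrite diameter0 lee_fin ltW.
apply: (@le_trans _ _ (hausdorff1_delta d 1 set0)).
  apply: le_ereal_inf_tmp => _ [U _ <-].
  by apply: nneseries_ge0 => *; exact: diameter_ge0.
by apply: ereal_sup_ubound; exists 1 => /=.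
Qed.

Variables (g : {mfun measurableTypeR R >-> borel d}) (a b K : R).
Hypothesis K0 : 0 <= K.
Hypothesis g_expanding : forall s t : R, s \in `[a, b] -> t \in `[a, b] ->
  `|s - t| <= K * d (g s) (g t).

(** A set of diameter [r] is met by the curve at parameters which lie within
   [K r] of any one of them. *)
Lemma expanding_preimage_null (A : set (borel d)) : measurable A ->
  hausdorff1 d A = 0%E -> lebesgue_measure (g @^-1` A `&` `[a, b]) = 0%E.
Proof.
move=> mA HA; have mgA : measurable (g @^-1` A).
  by rewrite -[X in measurable X]setTI; exact: measurable_funP.
apply/eqP; rewrite eq_le measure_ge0 andbT.
apply/lee_addgt0Pr => e e0; rewrite add0e.
(* The summand 1 covers the case [K = 0]. *)
have K1 : 0 < 2 * K + 1 by rewrite ltr_wpDl// mulr_ge0.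
have : (hausdorff1_delta d 1 A < (e / (2 * K + 1))%:E)%E.
  apply: (@le_lt_trans _ _ 0%E); last by rewrite lte_fin divr_gt0.
  by rewrite -HA; apply: ereal_sup_ubound; exists 1 => /=.
move=> /ereal_inf_lt[_ [U [AU U1] <-] Ue].
(* The interval [J i] is centred at a parameter chosen in [S i]; if [S i] is
   empty it is centred at 0, and only its length matters. *)
pose S i := [set t | t \in `[a, b] /\ U i (g t)].
pose r i := K * fine (diameter d (U i)).
have fin_diam i : diameter d (U i) \is a fin_num.
  by rewrite ge0_fin_numE ?diameter_ge0// (le_lt_trans (U1 i)) ?ltry.
pose J i : set R := let s := xget 0 (S i) in
  [set` `[s - r i, s + r i]].
have SJ i : S i `<=` J i.
  move=> t St; rewrite /J; case: xgetP => [s _ Ss|/(_ t)//].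
  have : `|s - t| <= r i.
    apply: le_trans (g_expanding (proj1 Ss) (proj1 St)) _.
    by rewrite ler_wpM2l// -lee_fin fineK// le_diameter//; [case: Ss|case: St].
  by rewrite /= in_itv/= ler_distlC.
have muJ i : (lebesgue_measure (J i) <= (2 * K)%:E * diameter d (U i))%E.
  rewrite /J lebesgue_measure_itv/= lte_fin; case: ifPn => _; last first.
    by rewrite mule_ge0 ?diameter_ge0// lee_fin mulr_ge0.
  rewrite -(fineK (fin_diam i)) -EFinB -EFinM lee_fin /r; lra.
apply: (@le_trans _ _ (\sum_(0 <= i <oo) lebesgue_measure (J i))%E).
  apply: measure_sigma_subadditive => //.
  - by move=> i; exact: measurable_itv.
  - exact: measurableI.
  - move=> t [/AU[i _ Ui] tab]; exists i => //; exact: SJ.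
apply: (@le_trans _ _ (\sum_(0 <= i <oo) (2 * K)%:E * diameter d (U i))%E).
  by apply: lee_nneseries => // i _; exact: measure_ge0.
rewrite nneseriesZl; last by move=> i _; exact: diameter_ge0.
have s0 : (0 <= \sum_(0 <= i <oo) diameter d (U i))%E.
  by apply: nneseries_ge0 => *; exact: diameter_ge0.
apply: (@le_trans _ _ ((2 * K + 1)%:E * (e / (2 * K + 1))%:E)%E).
  apply: lee_pmul => //; [by rewrite lee_fin mulr_ge0| |exact: ltW].
  by rewrite lee_fin lerDl.
by rewrite -EFinM mulrC divfK ?gt_eqF.
Qed.

(** A curve which contracts distances at most by a constant factor meets a
    Hausdorff null set at a Lebesgue null set of parameters. *)
Lemma uniform_law_dominated (ab : a < b) :
  (distribution (uniform_prob ab) g : {measure set (borel d) -> \bar R})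
    `<< hausdorff1 d.
Proof.
move=> N HN A mA AN; have mgA : measurable (g @^-1` A).
  by rewrite -[X in measurable X]setTI; exact: measurable_funP.
rewrite /distribution /pushforward/= /uniform_prob integral_uniform_pdf.
apply: null_set_integral => //.
- exact: measurableI.
- apply: measurable_funTS; apply/measurable_EFinP.
  exact: measurable_uniform_pdf.
exact: expanding_preimage_null (HN _ mA AN).
Qed.

End hausdorff_absolute_continuity.

(** * The lollipop graph *)

(** A lollipop: a cycle through [root] and [fork], whose two arcs have length
    2, with a stick of length 1 attached at [fork].  The vertex [side] cuts one
    of the two arcs, so that there are no multiple edges. *)
Inductive lollipop_vertex := root | side | fork | tip.
Inductive lollipop_edge := root_side | side_fork | root_fork | fork_tip.

HB.instance Definition _ := gen_eqMixin lollipop_vertex.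
HB.instance Definition _ := gen_choiceMixin lollipop_vertex.
HB.instance Definition _ := isPointed.Build lollipop_vertex root.
HB.instance Definition _ := gen_eqMixin lollipop_edge.
HB.instance Definition _ := gen_choiceMixin lollipop_edge.

Section lollipop.
Context {R : realType}.

Definition lollipop_src (e : lollipop_edge) : lollipop_vertex :=
  match e with
  | root_side => root | side_fork => side | root_fork => root | fork_tip => fork
  end.

Definition lollipop_tgt (e : lollipop_edge) : lollipop_vertex :=
  match e with
  | root_side => side | side_fork => fork | root_fork => fork | fork_tip => tip
  end.

Definition vertex_height (v : lollipop_vertex) : R :=
  match v with root => 0 | side => 1 | fork => 2 | tip => 3 end.

Definition lollipop_length (e : lollipop_edge) : R :=
  vertex_height (lollipop_tgt e) - vertex_height (lollipop_src e).

Lemma lollipop_length_ge1 e : 1 <= lollipop_length e.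
Proof. by rewrite /lollipop_length; case: e => /=; lra. Qed.

Lemma lollipop_vertex_finite : finite_set [set: lollipop_vertex].
Proof.
apply: (sub_finite_set _ (finite_seq [:: root; side; fork; tip])).
by case=> _ /=; rewrite !inE eqxx ?orbT.
Qed.

Lemma lollipop_edge_finite (A : set lollipop_edge) : finite_set A.
Proof.
apply: (sub_finite_set _
  (finite_seq [:: root_side; side_fork; root_fork; fork_tip])).
by case=> _ /=; rewrite !inE eqxx ?orbT.
Qed.

Lemma lollipop_no_loop e : lollipop_src e <> lollipop_tgt e.
Proof. by case: e. Qed.

Lemma lollipop_endpoints_inj :
  injective (fun e => [set lollipop_src e; lollipop_tgt e]).
Proof.
move=> e f ef.
have : [set lollipop_src f; lollipop_tgt f] (lollipop_src e).
  by rewrite -ef; left.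
have : [set lollipop_src f; lollipop_tgt f] (lollipop_tgt e).
  by rewrite -ef; right.
have : [set lollipop_src e; lollipop_tgt e] (lollipop_src f).
  by rewrite ef; left.
by case: e f {ef} => -[] //= [] // _ [] // _ [].
Qed.

(** Every vertex other than [fork] is adjacent to [fork]. *)
Lemma lollipop_connected (v w : lollipop_vertex) :
  exists p : seq lollipop_vertex,
  path (fun a b => `[< exists e,
    [set lollipop_src e; lollipop_tgt e] = [set a; b] >]) v p /\ last v p = w.
Proof.
pose adj (a b : lollipop_vertex) :=
  `[< exists e, [set lollipop_src e; lollipop_tgt e] = [set a; b] >].
suff : exists p, path adj v p /\ last v p = w by [].
have adjC a b : adj a b = adj b a.
  by apply: asbool_equiv_eq; split=> -[e he]; exists e; rewrite he setUC.
have adj_fork a : a <> fork -> adj a fork.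
  by case: a => // _; apply/asboolP; [exists root_fork|exists side_fork|
    exists fork_tip; rewrite setUC].
exists ((if v == fork then [::] else [:: fork]) ++
        (if w == fork then [::] else [:: w])).
case: (eqVneq v fork) => [->|/eqP vf];
  case: (eqVneq w fork) => [->|/eqP wf] //=.
- by rewrite adjC adj_fork.
- by rewrite adj_fork.
- by rewrite adj_fork// adjC adj_fork.
Qed.

Lemma lollipop_degree_ge1 v :
  [set e | v = lollipop_src e \/ v = lollipop_tgt e] !=set0.
Proof.
by case: v; [exists root_side; left|exists side_fork; left|
  exists fork_tip; left|exists fork_tip; right].
Qed.

Lemma lollipop_length_inf : 0 < inf (range lollipop_length).
Proof.
apply: (@lt_le_trans _ _ 1) => //; apply: lb_le_inf.
  by exists (lollipop_length root_side), root_side.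
by move=> _ [e _ <-]; exact: lollipop_length_ge1.
Qed.

Definition lollipop : metric_graph R :=
  @MetricGraph R lollipop_vertex lollipop_edge lollipop_src lollipop_tgt
    lollipop_length (finite_set_countable lollipop_vertex_finite)
    lollipop_no_loop lollipop_endpoints_inj lollipop_connected
    (fun v => lollipop_edge_finite _) lollipop_degree_ge1
    (fun e => le_trans ler01 (lollipop_length_ge1 e)) lollipop_length_inf.

Local Notation d := (graph_dist lollipop).
Local Notation pt := (@on_graph R lollipop).

(** Edges are oriented upwards, and the length of each is the difference of the
    heights of its ends: the height is affine of slope 1 on every edge. *)
Definition height : point_of lollipop -> R :=
  interpolate (vertex_height : vertex lollipop -> R).

Lemma height_on_graph e c : 0 <= c <= lollipop_length e ->
  height (pt e c) = vertex_height (lollipop_src e) + c.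
Proof.
move=> cl; rewrite /height interpolate_on_graph//= -/(lollipop_length e).
rewrite mulrCA divff ?mulr1// gt_eqF//.
exact: lt_le_trans ltr01 (lollipop_length_ge1 e).
Qed.

Lemma height_lipschitz x y : `|height x - height y| <= d x y.
Proof.
apply: interpolate_lipschitz => e /=; rewrite -/(lollipop_length e) ger0_norm//.
exact: le_trans ler01 (lollipop_length_ge1 e).
Qed.

Lemma pt_root : pt root_fork 0 = pt root_side 0.
Proof. exact: on_graph_src. Qed.

Lemma pt_side : pt root_side 1 = pt side_fork 0.
Proof.
rewrite -(@on_graph_tgt _ lollipop root_side side_fork)//=.
by rewrite /lollipop_length/= subr0.
Qed.

Lemma pt_fork_side : pt side_fork 1 = pt fork_tip 0.
Proof.
rewrite -(@on_graph_tgt _ lollipop side_fork fork_tip)//=.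
by congr on_graph; rewrite /lollipop_length/=; lra.
Qed.

Lemma pt_fork_root : pt root_fork 2 = pt fork_tip 0.
Proof.
rewrite -(@on_graph_tgt _ lollipop root_fork fork_tip)//=.
by rewrite /lollipop_length/= subr0.
Qed.

Definition root_point : point_of lollipop := pt root_fork 0.

(** The height of a point is its distance to the root. *)
Lemma dist_root e c : 0 <= c <= lollipop_length e ->
  d root_point (pt e c) = vertex_height (lollipop_src e) + c.
Proof.
move=> cl; apply/eqP; rewrite eq_le; apply/andP; split; last first.
  have := height_lipschitz (pt e c) root_point; rewrite graph_distC.
  apply: le_trans; rewrite !height_on_graph//=; last first.
    by rewrite lexx (le_trans ler01 (lollipop_length_ge1 _)).
  by rewrite addr0 subr0 ler_norm.
have {cl}/andP[c0 _] := cl.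
have step (e' : lollipop_edge) (a b r : R) :
    a <= b -> d root_point (pt e' a) <= r ->
    d root_point (pt e' b) <= r + (b - a).
  move=> ab ra; apply: le_trans (graph_dist_triangle (pt e' a) _ _) _.
  apply: lerD => //; apply: le_trans (graph_dist_on_graph _ _ _) _.
  by rewrite ler0_norm ?subr_le0// opprB.
have r0 : d root_point (pt root_fork 0) <= 0 by rewrite graph_distxx.
have r1 : d root_point (pt root_side 0) <= 0 by rewrite -pt_root graph_distxx.
have r2 : d root_point (pt side_fork 0) <= 1.
  by rewrite -pt_side; have := step _ _ _ _ ler01 r1; rewrite add0r subr0.
have r3 : d root_point (pt fork_tip 0) <= 2.
  rewrite -pt_fork_root; have := step _ _ 2 _ _ r0.
  by rewrite add0r subr0; apply.
by case: e => /=; rewrite -[X in _ + X]subr0; exact: step.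
Qed.

Lemma dist_lollipop_le x y : d x y <= 6.
Proof.
have root_le z : d root_point z <= 3.
  have [e [c [cl ->]]] := on_graph_surj z; rewrite dist_root//.
  by case/andP: cl => _; rewrite /=/lollipop_length; case: e => /=; lra.
apply: le_trans (graph_dist_triangle root_point _ _) _.
by rewrite (graph_distC x); have := root_le x; have := root_le y; lra.
Qed.

(** The stick, and the two midpoints between [root] and a point of the stick:
    one on each arc of the cycle, both at height [1 + t / 2]. *)
Definition stick_fun (t : R) : point_of lollipop := pt fork_tip (clamp 1 t).

Definition midpoint_fun (left : bool) (t : R) : point_of lollipop :=
  if left then pt side_fork (clamp 1 t / 2)
  else pt root_fork (1 + clamp 1 t / 2).

End lollipop.

Section lollipop_barycenters.
Context {R : realType}.
Local Notation d := (graph_dist (@lollipop R)).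
Local Notation pt := (@on_graph R lollipop).

Lemma stick_lipschitz (s t : R) : d (stick_fun s) (stick_fun t) <= `|s - t|.
Proof.
exact: le_trans (graph_dist_on_graph _ _ _) (clamp_lipschitz 1 s t).
Qed.

Lemma midpoint_lipschitz left (s t : R) :
  d (midpoint_fun left s) (midpoint_fun left t) <= `|s - t|.
Proof.
have half : `|clamp 1 s / 2 - clamp 1 t / 2| <= `|s - t|.
  rewrite -mulrBl normrM (@ger0_norm _ 2^-1)//.
  have := clamp_lipschitz 1 s t.
  by have := normr_ge0 (clamp 1 s - clamp 1 t); lra.
case: left; apply: le_trans (graph_dist_on_graph _ _ _) _ => //.
by rewrite opprD addrACA subrr add0r.
Qed.

Definition stick : {mfun measurableTypeR R >-> borel d} :=
  HB.pack (stick_fun : measurableTypeR R -> borel d)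
    (isMeasurableFun.Build _ _ _ _ _ (curve_measurable stick_lipschitz)).

Definition midpoint left : {mfun measurableTypeR R >-> borel d} :=
  HB.pack (midpoint_fun left : measurableTypeR R -> borel d)
    (isMeasurableFun.Build _ _ _ _ _
      (curve_measurable (midpoint_lipschitz left))).

Lemma dist_root_stick t : d root_point (stick t) = 2 + clamp 1 t.
Proof.
have /andP[c0 c1] := clamp_itv t ler01.
by rewrite /= dist_root// /lollipop_length/= c0/=; lra.
Qed.

Lemma height_midpoint left t : height (midpoint left t) = 1 + clamp 1 t / 2.
Proof.
have /andP[c0 c1] := clamp_itv t ler01; rewrite /= /midpoint_fun.
by case: left; rewrite height_on_graph/= /lollipop_length/=; lra.
Qed.

Lemma dist_midpoint_root left t :
  d (midpoint left t) root_point <= d root_point (stick t) / 2.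
Proof.
have /andP[c0 c1] := clamp_itv t ler01.
rewrite graph_distC dist_root_stick /= /midpoint_fun.
by case: left; rewrite dist_root/= /lollipop_length/=; lra.
Qed.

Lemma dist_midpoint_stick left t :
  d (midpoint left t) (stick t) <= d root_point (stick t) / 2.
Proof.
have /andP[c0 c1] := clamp_itv t ler01.
rewrite dist_root_stick /= /midpoint_fun /stick_fun.
apply: le_trans (graph_dist_triangle (pt fork_tip 0) _ _) _.
apply: (@le_trans _ _ ((1 - clamp 1 t / 2) + clamp 1 t)); last by lra.
apply: lerD.
  case: left; [rewrite -pt_fork_side|rewrite -pt_fork_root];
    by apply: le_trans (graph_dist_on_graph _ _ _) _; rewrite ler0_norm; lra.
apply: le_trans (graph_dist_on_graph _ _ _) _.
by rewrite sub0r normrN ger0_norm.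
Qed.

Variable P : probability (measurableTypeR R) R.
Local Notation law := (law (@graph_dist_ge0 _ lollipop) dist_lollipop_le P).

(** Mass 1/2 at the Dirac mass at [root], and mass 1/2 at a measure on the
    stick. *)
Definition root_and_stick : W2 (dW d) :=
  half_half (@graph_dist_ge0 _ lollipop) dist_lollipop_le
    (law (cst (root_point : borel d))) (law stick).

Lemma midpoint_is_barycenter left :
  is_barycenter root_and_stick (law (midpoint left)).
Proof.
apply: midpoint_barycenter.
- exact: graph_distxx.
- exact: graph_distC.
- exact: graph_dist_triangle.
- exact: dist_midpoint_root.
- exact: dist_midpoint_stick.
Qed.

End lollipop_barycenters.

(** * Two distinct barycenters *)

Section separation.
Context {R : realType}.
Local Notation d := (graph_dist (@lollipop R)).

(** The distance to [side], truncated at 1.  The midpoints on one arc are at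
    distance less than 1 from [side], those on the other arc are not. *)
Definition off_side : point_of (@lollipop R) -> R :=
  interpolate (fun v : vertex lollipop => if v is side then 0 else 1).

Lemma off_side_lipschitz x y : `|off_side x - off_side y| <= d x y.
Proof.
apply: interpolate_lipschitz => e; apply: le_trans (lollipop_length_ge1 e).
by case: e => /=; rewrite ?subrr ?subr0 ?sub0r ?normrN ?normr0 ?normr1.
Qed.

Definition near_side : set (borel d) := [set x | off_side x < 1].

Lemma measurable_near_side : measurable near_side.
Proof.
apply: metric_open_measurable => x /= x1.
exists (1 - off_side x); first by rewrite subr_gt0.
move=> y dxy; have := le_lt_trans (off_side_lipschitz x y) dxy.
by rewrite distrC => /(le_lt_trans (ler_norm _)); rewrite ltrBlDr subrK.
Qed.

Lemma near_side_midpoint (t : R) : near_side (midpoint true t).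
Proof.
have /andP[c0 c1] := clamp_itv t ler01; have l1 : 2 - 1 = 1 :> R by lra.
rewrite /near_side /off_side/= /midpoint_fun.
rewrite interpolate_on_graph/= /lollipop_length/= l1; last by lra.
by rewrite subr0 mul1r divr1 add0r; lra.
Qed.

Lemma not_near_side_midpoint (t : R) : ~ near_side (midpoint false t).
Proof.
have /andP[c0 c1] := clamp_itv t ler01.
rewrite /near_side /off_side/= /midpoint_fun.
rewrite interpolate_on_graph/= /lollipop_length/=; last by lra.
by rewrite subrr mul0r addr0 ltxx.
Qed.

End separation.

Theorem proposition1p3 (R : realType) :
  (exists (G : metric_graph R) (P : W2 (dW (graph_dist G)))
          (mu1 mu2 : W2 (graph_dist G)),
     [/\ is_barycenter P mu1, is_barycenter P mu2 &
         exists2 A : set (borel (graph_dist G)),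
           measurable A & atomic_part mu1 A <> atomic_part mu2 A]) /\
  (exists (G : metric_graph R) (P : W2 (dW (graph_dist G)))
          (mu1 mu2 : W2 (graph_dist G))
          (a1 a2 : {measure set (borel (graph_dist G)) -> \bar R}),
     [/\ is_barycenter P mu1, is_barycenter P mu2,
         is_ac_part (hausdorff1 (graph_dist G)) mu1 a1,
         is_ac_part (hausdorff1 (graph_dist G)) mu2 a2 &
         exists2 A : set (borel (graph_dist G)),
           measurable A & a1 A <> a2 A]).
Proof.
pose law (P : probability (measurableTypeR R) R) left :=
  law (@graph_dist_ge0 _ lollipop) dist_lollipop_le P (midpoint left).
have law_near_side P left : law P left near_side = (left%:R)%:E.
  rewrite /law/= /distribution /pushforward.
  case: left.
    rewrite (_ : _ @^-1` _ = setT) ?probability_setT//.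
    by apply/seteqP; split => t // _; exact: near_side_midpoint.
  rewrite (_ : _ @^-1` _ = set0) ?measure0//.
  by apply/seteqP; split => t // /not_near_side_midpoint.
split.
  pose t0 : measurableTypeR R := 0 : R.
  pose P : probability (measurableTypeR R) R := \d_t0.
  exists lollipop, (root_and_stick P), (law P true), (law P false).
  split; [exact: midpoint_is_barycenter..|].
  exists near_side; first exact: measurable_near_side.
  have -> : atomic_part (law P false) near_side = 0%E.
    apply: esum1 => x xs; apply: etrans (diracE _ _ _) _.
    rewrite memNset// => x0; apply: (@not_near_side_midpoint R t0).
    by move: xs; rewrite -x0.
  apply/eqP; rewrite gt_eqF//; apply: (@lt_le_trans _ _ 1%E) => //.
  apply: esum_ge; exists [set midpoint true t0].
    split; first exact: finite_set1.
    by move=> x ->; exact: near_side_midpoint.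
  rewrite fsbig_set1.
  change (1 <= \d_t0 (midpoint true @^-1` [set midpoint true t0]) :> \bar R)%E.
  by rewrite diracE mem_set.
pose P : probability (measurableTypeR R) R := uniform_prob (@ltr01 R).
exists lollipop, (root_and_stick P), (law P true), (law P false).
exists (law P true), (law P false).
(* Both barycenters are absolutely continuous: the singular part vanishes. *)
have ac left : is_ac_part (hausdorff1 (graph_dist lollipop))
    (law P left) (law P left).
  exists mzero; split.
  - (* The height increases at rate 1/2 along the curve of midpoints. *)
    apply: (@uniform_law_dominated _ _ _ _ _ _ 2) => // s t s01 t01.
    have := height_lipschitz (midpoint left s) (midpoint left t).
    rewrite !height_midpoint !clamp_id// opprD addrACA subrr add0r -mulrBl.
    by rewrite normrM (@ger0_norm _ 2^-1)// ler_pdivrMr// mulrC.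
  - by exists set0; split => //; exact: hausdorff1_set0.
  - by move=> A mA; rewrite /mzero/= adde0.
split; [exact: midpoint_is_barycenter..|exact: ac|exact: ac|].
exists near_side; first exact: measurable_near_side.
have := law_near_side P true; have := law_near_side P false => /= -> ->.
by move=> [] /eqP; rewrite oner_eq0.
Qed.
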